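(* Let $M$ be a positive integer and let $(a_{i_0i_1\dots i_M})$ and $(b_{i_1\dots i_M})$, with all indices in $\{1,\dots,s\}$, be the real coefficients of an $s$-stage NPRK$_M$ method. The method has order $p$ if and only if $$\Phi(\tau)=\frac{1}{\gamma(\tau)}$$ for all edge-colored rooted trees $\tau$ (with edge colors in $\{1,\dots,M\}$) such that $|\tau|\le p$.
   Context: **NPRK$_M$ method.** Let $X$ be a finite-dimensional real vector space, $F:X^M\to X$ ($M$ arguments) smooth, and consider the initial value problem $y'=F(y,\dots,y)$, $y(t_0)=y_0$. An $s$-stage NPRK$_M$ (nonlinearly partitioned Runge--Kutta with $M$ partitions) method with real coefficients $a_{i_0i_1\dots i_M}$, $b_{i_1\dots i_M}$ and step size $h$ is $$Y_{i_0}=y_n+h\sum_{i_1,\dots,i_M=1}^s a_{i_0i_1\dots i_M}F(Y_{i_1},\dots,Y_{i_M})\quad(i_0=1,\dots,s),$$ $$y_{n+1}=y_n+h\sum_{i_1,\dots,i_M=1}^s b_{i_1\dots i_M}F(Y_{i_1},\dots,Y_{i_M}).$$ For small $h$ the stages $Y_i=Y_i(h)$ are the solution of the stage equations near $y_n$ (with $Y_i(0)=y_n$). **Order.** The method has order $p$ if, for every such $X$, $F$, $t_0$, $y_0$, the numerical solution $y_1$ after one step of size $h$ from $y_0$ satisfies $y_1-y(t_0+h)=\mathcal{O}(h^{p+1})$ as $h\to0$, where $y$ is the exact solution. Equivalently, the Taylor expansions in $h$ at $h=0$ of $y_1$ and $y(t_0+h)$ agree up to and including the $h^p$ term. **Edge-colored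 rooted trees.** These are finite rooted trees in which each edge has a color in $\{1,\dots,M\}$, up to equivalence (the order in which children are listed is irrelevant). Recursively: the single node $\bullet$ is a tree, and if $\tau_1,\dots,\tau_m$ ($m\ge1$) are trees and $a_1,\dots,a_m\in\{1,\dots,M\}$, then $\tau=[\tau_1|_{a_1},\dots,\tau_m|_{a_m}]$ is the tree obtained by joining the root of each $\tau_l$ to a new root by an edge of color $a_l$. Lists differing by a permutation of the pairs $(\tau_l,a_l)$ define the same tree. The order $|\tau|$ is the number of nodes of $\tau$. The density is $\gamma(\bullet)=1$, $\gamma(\tau)=|\tau|\,\gamma(\tau_1)\cdots\gamma(\tau_m)$ for $\tau=[\tau_1|_{a_1},\dots,\tau_m|_{a_m}]$. **Elementary weights.** The indexed elementary weights are $\phi_{i_1\dots i_M}(\bullet)=1$ and, for $\tau=[\tau_1|_{a_1},\dots,\tau_m|_{a_m}]$, $$\phi_{i_1\dots i_M}(\tau)=\prod_{l=1}^m\Big(\sum_{k_1,\dots,k_M=1}^s a_{i_{a_l}k_1\dots k_M}\,\phi_{k_1\dots k_M}(\tau_l)\Big),$$ i.e. each non-root node is labeled by an $M$-multi-index, and an edge of color $a$ from a lower node labeled $j_1\dots j_M$ to an upper node labeled $k_1\dots k_M$ contributes the factor $a_{j_ak_1\dots k_M}$, with summation over all non-root indices. The elementary weight is $$\Phi(\tau)=\sum_{i_1,\dots,i_M=1}^s b_{i_1\dots i_M}\phi_{i_1\dots i_M}(\tau).$$ *)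

(* Defs.v *)
From HB Require Import structures.
From mathcomp Require Import all_boot all_order all_algebra.
From mathcomp Require Import all_classical all_reals all_analysis.

Set Implicit Arguments.
Unset Strict Implicit.
Unset Printing Implicit Defensive.

Import Order.TTheory GRing.Theory Num.Theory.
Import numFieldNormedType.Exports VectorInternalTheory.

Local Open Scope classical_set_scope.
Local Open Scope ring_scope.
Local Open Scope quotient_scope.

(* [nvect X] is the finite-dimensional space [X] with the sup norm of its
   coordinates.  All norms on [X] are equivalent, so that the topology, the
   derivatives and the Landau symbols on [nvect X] do not depend on this
   choice.  The power X^M is [{ffun 'I_M -> X}], which is again a vectType. *)
Definition nvect (R : realType) (X : vectType R) : Type := X.

Section nvect_theory.
Context (R : realType) (X : vectType R).

HB.instance Definition _ := GRing.Lmodule.on (nvect X).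

Definition nvect_norm (x : nvect X) : R := `| v2r (x : X) |.

Fact nvect_normD x y : nvect_norm (x + y) <= nvect_norm x + nvect_norm y.
Proof. by rewrite /nvect_norm linearD; exact: ler_normD. Qed.

Fact nvect_normZ (l : R) x : nvect_norm (l *: x) = `|l| * nvect_norm x.
Proof. by rewrite /nvect_norm linearZ normrZ. Qed.

Fact nvect_norm0_eq0 x : nvect_norm x = 0 -> x = 0.
Proof. by move/normr0_eq0 => x0; apply: v2r_inj; rewrite x0 linear0. Qed.

HB.instance Definition _ :=
  Lmodule_isNormed.Build R (nvect X) nvect_normD nvect_normZ nvect_norm0_eq0.

End nvect_theory.

Section smoothness.
Context (R : realType) (V W : normedModType R).

(* For finite-dimensional [V], continuity of [x |-> 'd f x v] for each fixed
   [v] is equivalent to continuity of ['d f] in the operator norm, and likewise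
   for the higher derivatives, so that this is the usual class C^n. *)
Fixpoint Cn (n : nat) (f : V -> W) : Prop :=
  if n is n'.+1 then
    (forall x, differentiable f x) /\ forall v, Cn n' (fun x => 'd f x v)
  else continuous f.

Definition smooth (f : V -> W) : Prop := forall n, Cn n f.

End smoothness.

Section method.
Context (R : realType) (M s : nat).

(* [a i0 k] is a_{i0 i1 .. iM} and [b k] is b_{i1 .. iM}, where [k l] is the
   index of the l-th argument. *)
Variables (a : 'I_s -> {ffun 'I_M -> 'I_s} -> R)
          (b : {ffun 'I_M -> 'I_s} -> R).

Section ivp.
Context (X : vectType R).
Variable F : nvect {ffun 'I_M -> X} -> nvect X.

Definition exact_solution (t0 : R) (y0 : nvect X) (y : R -> nvect X) : Prop :=
  y t0 = y0 /\
  \forall t \near t0, is_derive t (1 : R) y (F [ffun=> y t]).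

Definition stage_solution (y0 : nvect X) (Y : 'I_s -> R -> nvect X) : Prop :=
  [/\ forall i, Y i 0 = y0,
      forall i, {for (0 : R), continuous (Y i)} &
      \forall h \near (0 : R), forall i, Y i h = y0 + h *:
        (\sum_(k : {ffun 'I_M -> 'I_s}) a i k *: F [ffun l => Y (k l) h])].

Definition nprk_step (y0 : nvect X) (Y : 'I_s -> R -> nvect X) (h : R) :
    nvect X :=
  y0 + h *: (\sum_(k : {ffun 'I_M -> 'I_s}) b k *: F [ffun l => Y (k l) h]).

End ivp.

(* Near t0 and near h = 0 respectively, the exact solution and the stages exist
   and are unique, so that quantifying universally over [y] and [Y] amounts to
   speaking of the exact and of the numerical solution. *)
Definition has_order (p : nat) : Prop :=
  forall (X : vectType R) (F : nvect {ffun 'I_M -> X} -> nvect X)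
    (t0 : R) (y0 : nvect X) (y : R -> nvect X) (Y : 'I_s -> R -> nvect X),
  smooth F -> exact_solution F t0 y0 y -> stage_solution F y0 Y ->
  (fun h : R => nprk_step F y0 Y h - y (t0 + h))
    =O_ (nbhs (0 : R)) (fun h : R => h ^+ p.+1).

End method.

(* Trees with ordered children; edge-colored rooted trees are their quotient by
   the congruence [ptree_eq] generated by permutations of the children. *)
Inductive ptree (M : nat) : Type := PNode of seq (ptree M * 'I_M).

HB.instance Definition _ (M : nat) := gen_eqMixin (ptree M).
HB.instance Definition _ (M : nat) := gen_choiceMixin (ptree M).

Inductive ptree_eq (M : nat) : ptree M -> ptree M -> Prop :=
| ptree_eq_refl t : ptree_eq t t
| ptree_eq_sym t u : ptree_eq t u -> ptree_eq u t
| ptree_eq_trans t u v : ptree_eq t u -> ptree_eq u v -> ptree_eq t v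
| ptree_eq_perm cs ds : perm_eq cs ds -> ptree_eq (PNode cs) (PNode ds)
| ptree_eq_child t u c cs : ptree_eq t u ->
    ptree_eq (PNode ((t, c) :: cs)) (PNode ((u, c) :: cs)).

Section planar.
Context (M : nat).

Fixpoint porder (t : ptree M) : nat :=
  let: PNode cs := t in (foldr (fun c n => porder c.1 + n) 0 cs).+1%N.

Fixpoint pdensity (t : ptree M) : nat :=
  let: PNode cs := t in
  (porder t * foldr (fun c n => pdensity c.1 * n) 1 cs)%N.

Context (R : realType) (s : nat).
Variables (a : 'I_s -> {ffun 'I_M -> 'I_s} -> R)
          (b : {ffun 'I_M -> 'I_s} -> R).

Fixpoint pphi (t : ptree M) (i : {ffun 'I_M -> 'I_s}) : R :=
  let: PNode cs := t in
  foldr (fun c r =>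
    (\sum_(k : {ffun 'I_M -> 'I_s}) a (i c.2) k * pphi c.1 k) * r) 1 cs.

Lemma porderE cs : porder (PNode cs) = (\sum_(c <- cs) porder c.1).+1%N.
Proof. by rewrite unlock. Qed.

Lemma pdensityE cs :
  pdensity (PNode cs) = (porder (PNode cs) * \prod_(c <- cs) pdensity c.1)%N.
Proof. by rewrite unlock. Qed.

Lemma pphiE cs i : pphi (PNode cs) i =
  \prod_(c <- cs) \sum_(k : {ffun 'I_M -> 'I_s}) a (i c.2) k * pphi c.1 k.
Proof.
rewrite /=; elim: cs => [|c cs IH]; first by rewrite big_nil.
by rewrite big_cons -IH.
Qed.

Lemma ptree_eq_porder t u : ptree_eq t u -> porder t = porder u.
Proof.
elim=> // [{}t {}u v _ -> _ ->//|cs ds cd|{}t {}u c cs _ tu].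
  by rewrite !porderE (perm_big _ cd).
by rewrite !porderE !big_cons tu.
Qed.

Lemma ptree_eq_pdensity t u : ptree_eq t u -> pdensity t = pdensity u.
Proof.
elim=> // [{}t {}u v _ -> _ ->//|cs ds cd|{}t {}u c cs e tu].
  by rewrite !pdensityE (ptree_eq_porder (ptree_eq_perm cd)) (perm_big _ cd).
by rewrite !pdensityE (ptree_eq_porder (ptree_eq_child c cs e)) !big_cons tu.
Qed.

Lemma ptree_eq_pphi t u : ptree_eq t u -> pphi t =1 pphi u.
Proof.
elim=> [//|{}t {}u _ tu i|{}t {}u v _ tu _ uv i|cs ds cd i|
  {}t {}u c cs _ tu i].
- by rewrite tu.
- by rewrite tu uv.
- by rewrite !pphiE (perm_big _ cd).
- rewrite !pphiE !big_cons; congr (_ * _).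
  by apply: eq_bigr => k _; rewrite tu.
Qed.

End planar.

Section trees.
Context (M : nat).

Definition ptree_eqb (t u : ptree M) : bool := `[< ptree_eq t u >].

Fact ptree_eqb_refl : reflexive ptree_eqb.
Proof. by move=> t; apply/asboolP; exact: ptree_eq_refl. Qed.

Fact ptree_eqb_sym : symmetric ptree_eqb.
Proof. by move=> t u; apply/asboolP/asboolP; exact: ptree_eq_sym. Qed.

Fact ptree_eqb_trans : transitive ptree_eqb.
Proof.
move=> u t v /asboolP tu /asboolP uv; apply/asboolP.
exact: ptree_eq_trans tu uv.
Qed.

Canonical ptree_equiv :=
  EquivRel ptree_eqb ptree_eqb_refl ptree_eqb_sym ptree_eqb_trans.

Definition ectree : Type := {eq_quot ptree_equiv}.
HB.instance Definition _ := EqQuotient.on ectree.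

(* [graft [:: (t1, c1); ..; (tm, cm)]] is the tree [t1|_c1, ..., tm|_cm]. *)
Definition graft (cs : seq (ectree * 'I_M)) : ectree :=
  \pi_ectree (PNode [seq (repr c.1, c.2) | c <- cs]).

Definition tree_order (tau : ectree) : nat := porder (repr tau).
Definition density (tau : ectree) : nat := pdensity (repr tau).

Context (R : realType) (s : nat).
Variables (a : 'I_s -> {ffun 'I_M -> 'I_s} -> R)
          (b : {ffun 'I_M -> 'I_s} -> R).

Definition phi (tau : ectree) (i : {ffun 'I_M -> 'I_s}) : R :=
  pphi a (repr tau) i.

Definition Phi (tau : ectree) : R :=
  \sum_(i : {ffun 'I_M -> 'I_s}) b i * phi tau i.

Lemma ptree_eq_repr t : ptree_eq (repr (\pi_ectree t)) t.
Proof.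
by apply/asboolP; rewrite -[asbool _]/(ptree_equiv _ _) -eqmodE reprK.
Qed.

Lemma graft_perm cs ds : perm_eq cs ds -> graft cs = graft ds.
Proof.
move=> cd; apply/eqmodP/asboolP/ptree_eq_perm; exact: perm_map.
Qed.

Lemma graft_surj tau : exists cs, tau = graft cs.
Proof.
case def_tau: (repr tau) => [cs].
exists [seq (\pi_ectree c.1, c.2) | c <- cs].
rewrite -[tau]reprK def_tau; apply/eqmodP/asboolP; rewrite -map_comp.
rewrite -[X in ptree_eq (PNode X)]cats0 -[X in ptree_eq _ (PNode X)]cats0.
elim: cs [::] {def_tau} => [|[t c] cs IH] ds /=; first exact: ptree_eq_refl.
apply: ptree_eq_trans (ptree_eq_child _ _ (ptree_eq_sym (ptree_eq_repr t))) _.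
apply: (@ptree_eq_trans _ _ (PNode (cs ++ (repr (\pi_ectree t), c) :: ds))).
  by apply: ptree_eq_perm; rewrite -cat1s perm_catCA.
apply: ptree_eq_trans (IH _) _; apply: ptree_eq_perm.
by rewrite -[X in perm_eq _ X]cat1s perm_sym perm_catCA.
Qed.

Lemma tree_order_graft cs :
  tree_order (graft cs) = (\sum_(c <- cs) tree_order c.1).+1%N.
Proof.
by rewrite /tree_order (ptree_eq_porder (ptree_eq_repr _)) porderE big_map.
Qed.

Lemma density_graft cs :
  density (graft cs) = (tree_order (graft cs) * \prod_(c <- cs) density c.1)%N.
Proof.
rewrite /density (ptree_eq_pdensity (ptree_eq_repr _)) pdensityE big_map.
by rewrite /tree_order (ptree_eq_porder (ptree_eq_repr _)).
Qed.

Lemma phi_graft cs i : phi (graft cs) i =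
  \prod_(c <- cs) \sum_(k : {ffun 'I_M -> 'I_s}) a (i c.2) k * phi c.1 k.
Proof. by rewrite /phi (ptree_eq_pphi _ (ptree_eq_repr _)) pphiE big_map. Qed.

End trees.

(* Main.v *)
From HB Require Import structures.
Require Import Defs.
From mathcomp Require Import all_boot all_order all_algebra.
From mathcomp Require Import all_classical all_reals all_analysis.
From mathcomp Require Import ring lra.

Set Implicit Arguments.
Unset Strict Implicit.
Unset Printing Implicit Defensive.

Local Open Scope ring_scope.
Import Order.TTheory GRing.Theory Num.Theory.
Import numFieldNormedType.Exports VectorInternalTheory.
Local Open Scope classical_set_scope.

(** Both directions compare, power by power in h, the numerical and the exact
    solution of y' = F (y, .., y).

    Trees suffice: Taylor's formula writes F at (Y_1, .., Y_M) as the sum over m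
    of the m-th differential of F at the diagonal point (y0, .., y0), applied m
    times to the increment and divided by m!.  If each Y_l - y0 is, up to an
    error of order h^(n+1), a sum over planar trees t of
    c_l(t) h^|t| times a vector D(t), then expanding by multilinearity produces
    one term for each list of pairs (child, slot), that is, for each planar tree
    [PNode cs]; its coefficient is the product of the c_l(t) over the children
    and its vector is the differential applied to the D(t).  This is
    [bseries_step].  Working with planar trees and with the weights 1/m!
    absorbed in D(t) avoids symmetry coefficients, and nothing is truncated
    along the way because trees of excessive order may stay in the sum.  The
    step is iterated twice: in the stage equations it yields the weights
    [stage_weight] ([stage_bseries]), hence the elementary weight for the
    numerical solution; combined with an integration in h, which divides the
    coefficient of each tree by its order, it yields 1/gamma for the exact
    solution ([exact_bseries]).  The difference of the two expansions has the
    coefficient Phi(t) - 1/gamma(t) at t, so that the conditions up to order p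
    leave O(h^(p+1)).

    Trees are needed: for a given tree t, let the unknowns be indexed by the
    subtrees of t, and let the component of F at [PNode cs] be the product over
    the children (c, l) of the component at c of the l-th argument
    ([tree_field]).  This polynomial system is triangular, and both the exact
    solution and the stages are explicit monomials in h.  At the component of t
    itself, the numerical and the exact solution differ by exactly
    (Phi(t) - 1/gamma(t)) h^|t|, which is O(h^(p+1)) with |t| <= p only if
    it vanishes. *)

(** * Coordinates on finite-dimensional spaces and the mean value inequality *)

Section Coordinates.
Context (R : realType) (X : vectType R).
Implicit Types x : nvect X.

Definition coor (i : 'I_(dim X)) (x : nvect X) : R := v2r (x : X) 0 i.
Definition bvec (i : 'I_(dim X)) : nvect X := r2v (delta_mx 0 i).

Lemma coor_is_linear i : linear (coor i : nvect X -> R^o).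
Proof. by move=> a x y; rewrite /coor [v2r _]linearP !mxE. Qed.
HB.instance Definition _ i :=
  GRing.isLinear.Build R (nvect X) R^o _ (coor i) (coor_is_linear i).

Lemma sum_coor x : x = \sum_i coor i x *: bvec i.
Proof.
apply: v2r_inj; rewrite [LHS]row_sum_delta [RHS]linear_sum.
by apply: eq_bigr => i _; rewrite [RHS]linearZ /= /bvec r2vK.
Qed.

Lemma nvect_normE x : `|x| = `|v2r (x : X)|. Proof. by []. Qed.

Lemma normr_coor i x : `|coor i x| <= `|x|.
Proof.
rewrite nvect_normE [leRHS]mx_normrE.
exact: (le_bigmax 0 (fun ij => `|v2r (x : X) ij.1 ij.2|) (0, i)).
Qed.

Lemma nvect_norm_le x (c : R) :
  0 <= c -> (forall i, `|coor i x| <= c) -> `|x| <= c.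
Proof.
move=> c0 xc; rewrite nvect_normE [leLHS]mx_normrE.
by apply/bigmax_leP; split=> // -[u i] _ /=; rewrite ord1; exact: xc.
Qed.

Lemma linear_sum_coor (W : lmodType R) (f : {linear nvect X -> W}) x :
  f x = \sum_i coor i x *: f (bvec i).
Proof.
rewrite [x in LHS]sum_coor linear_sum.
by apply: eq_bigr => i _; rewrite linearZ.
Qed.

(** A linear map is determined by its values on the finite basis, which
    bounds it by a multiple of the sup norm. *)
Lemma nvect_linear_continuous (W : normedModType R)
  (f : {linear nvect X -> W}) : continuous f.
Proof.
apply: bounded_linear_continuous; apply/linear_boundedP.
exists (\sum_i `|f (bvec i)|); split; first exact: num_real.
move=> r rgt x; rewrite linear_sum_coor; apply: (le_trans (ler_norm_sum _ _ _)).
apply: (@le_trans _ _ ((\sum_i `|f (bvec i)|) * `|x|)).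
  rewrite mulr_suml; apply: ler_sum => i _.
  by rewrite normrZ mulrC ler_wpM2l // normr_coor.
by rewrite ler_wpM2r // ltW.
Qed.

Lemma nvect_linear_lipschitz (W : normedModType R)
  (f : {linear nvect X -> W}) :
  exists2 k, 0 < k & forall x, `|f x| <= k * `|x|.
Proof. exact: linear_lipschitz (@nvect_linear_continuous _ f). Qed.

End Coordinates.

Section Curves.
Context (R : realType).

Lemma is_derive_diff_comp (V W : normedModType R) (f : V -> W) (u : R -> V)
    (t : R) (du : V) :
  differentiable f (u t) -> is_derive t 1 u du ->
  is_derive t 1 (f \o u) ('d f (u t) du).
Proof.
move=> df [/derivable1_diffP du1 duE].
have dfu : differentiable (f \o u) t by exact: differentiable_comp.
apply: DeriveDef; first exact/derivable1_diffP.
by rewrite deriveE // diff_comp //= -duE deriveE.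
Qed.

Lemma is_derive_linear_comp (V W : normedModType R) (f : {linear V -> W})
    (u : R -> V) (t : R) (du : V) :
  continuous f -> is_derive t 1 u du -> is_derive t 1 (f \o u) (f du).
Proof.
move=> fc uD; have := is_derive_diff_comp (linear_differentiable _ fc) uD.
by rewrite diff_lin.
Qed.

(** The mean value theorem fails for vector-valued curves, but the
    inequality follows from the scalar theorem applied to each coordinate,
    since the norm is the largest absolute value of a coordinate. *)
Lemma nvect_MVT (X : vectType R) (u du : R -> nvect X) (c : R) :
  (forall t : R, 0 <= t <= 1 -> is_derive t 1 u (du t)) ->
  (forall t : R, 0 <= t <= 1 -> `|du t| <= c) -> `|u 1 - u 0| <= c.
Proof.
move=> uD duc; have c0 : 0 <= c.
  by apply: le_trans (duc 0 _); rewrite ?lexx ?ler01.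
apply: nvect_norm_le => // i; rewrite [coor _ _](linearB (coor i)).
have uiD (t : R) : 0 <= t <= 1 ->
    is_derive t 1 (coor i \o u : R -> R^o) (coor i (du t)).
  by move=> /uD; apply: is_derive_linear_comp; exact: nvect_linear_continuous.
have [||t] := @MVT_segment R (coor i \o u) (coor i \o du) 0 1 ler01.
- move=> t; rewrite in_itv /= => /andP[/ltW t0 /ltW t1].
  by apply: uiD; rewrite t0.
- apply: derivable_within_continuous => t; rewrite in_itv /= => /uiD.
  by case.
- rewrite in_itv /= subr0 mulr1 => t01 ->.
  exact: le_trans (normr_coor _ _) (duc _ t01).
Qed.

End Curves.

(** * Iterated differentials and the formula of Taylor *)

Section IteratedDifferentials.
Context (R : realType) (V W : normedModType R).
Implicit Types (f g : V -> W) (v : V).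

Lemma smooth_differentiable f x : smooth f -> differentiable f x.
Proof. by move=> /(_ 1%N) [fd _]; exact: fd. Qed.

Lemma smooth_diff f v : smooth f -> smooth (fun x => 'd f x v).
Proof. by move=> fs n; have [_] := fs n.+1; exact. Qed.

(** [idiff [:: v1; ..; vm] f x] is the m-th differential of [f] at [x]
    applied to the [vi]. Differentiating along [v1] first, in the manner of
    [Cn], makes linearity in [f] the basic property, with induction on the
    list. *)
Fixpoint idiff (vs : seq V) f : V -> W :=
  if vs is v :: vs' then idiff vs' (fun x => 'd f x v) else f.

Lemma diff_comb (I : Type) (r : seq I) (al : I -> R) (g : I -> V -> W) x :
  (forall i, differentiable (g i) x) ->
  is_diff x (fun y => \sum_(i <- r) al i *: g i y)
            (fun v => \sum_(i <- r) al i *: 'd (g i) x v).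
Proof.
move=> gd; elim: r => [|i r IH].
  rewrite (_ : (fun y => _) = cst 0); last by apply/funext=> y; rewrite big_nil.
  rewrite (_ : (fun v => _) = 0); last by apply/funext=> y; rewrite big_nil.
  exact: is_diff_cst.
have giD : is_diff x (g i) ('d (g i) x) by exact/differentiableP.
have := is_diffD (is_diffZ (al i) giD) IH.
by congr (is_diff_def _ _ _); apply/funext => y; rewrite big_cons.
Qed.

(** Linearity in the function passes through all later differentiations.
    Since ['d f x v] is linear in [v], this also gives multilinearity in the
    directions. *)
Lemma idiff_comb (I : Type) (r : seq I) (al : I -> R) (g : I -> V -> W) vs :
  (forall i, smooth (g i)) ->
  idiff vs (fun x => \sum_(i <- r) al i *: g i x) =
  (fun x => \sum_(i <- r) al i *: idiff vs (g i) x).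
Proof.
elim: vs g => [//|v vs IH] g gs /=.
rewrite -IH; last by move=> i; exact: smooth_diff.
congr idiff; apply/funext => x.
have gsD := diff_comb r al (fun i => smooth_differentiable x (gs i)).
by rewrite diff_val.
Qed.

Lemma idiff_nseqZ m (t : R) v f x : smooth f ->
  idiff (nseq m (t *: v)) f x = t ^+ m *: idiff (nseq m v) f x.
Proof.
elim: m f => [|m IH] f fs /=; first by rewrite expr0 scale1r.
rewrite (_ : (fun y => _) = (fun y => \sum_(i <- [:: tt]) t *: 'd f y v)).
  rewrite idiff_comb; last by move=> _; exact: smooth_diff.
  by rewrite big_seq1 IH ?scalerA ?exprS //; exact: smooth_diff.
by apply/funext => y; rewrite big_seq1 linearZ.
Qed.

End IteratedDifferentials.

Section Words.

Fixpoint words (I : Type) (L : seq I) (m : nat) : seq (seq I) :=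
  if m is m'.+1 then [seq c :: cs | c <- L, cs <- words L m'] else [:: [::]].

(** The multinomial expansion of the m-th differential on the diagonal,
    indexed by words instead of multisets so that no multinomial coefficient
    appears. *)
Lemma idiff_nseq_comb (R : realType) (V W : normedModType R) (I : Type)
    (L : seq I) (al : I -> R) (e : I -> V) m (f : V -> W) x : smooth f ->
  idiff (nseq m (\sum_(c <- L) al c *: e c)) f x =
  \sum_(cs <- words L m) (\prod_(c <- cs) al c) *: idiff (map e cs) f x.
Proof.
elim: m f => [|m IH] f fs /=; first by rewrite big_seq1 big_nil scale1r.
rewrite (_ : (fun y => _) =
  (fun y => \sum_(c <- L) al c *: 'd f y (e c))); last first.
  apply/funext => y; rewrite linear_sum.
  by apply: eq_bigr => c _; rewrite linearZ.
rewrite idiff_comb; last by move=> c; exact: smooth_diff.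
rewrite big_allpairs_dep; apply: eq_bigr => c _.
rewrite IH ?scaler_sumr; last exact: smooth_diff.
by apply: eq_bigr => cs _; rewrite scalerA big_cons.
Qed.

End Words.

Section PolynomialCurves.
Context (R : realType) (W : normedModType R).

Lemma is_derive_scalel (w : W) (c : R -> R) (t dc : R) :
  is_derive t 1 c dc -> is_derive t 1 (fun t => c t *: w) (dc *: w).
Proof.
move=> cD; have wD := is_diff_scalel (c t) w.
have wd : differentiable ( *:%R^~ w : R -> W) (c t) by [].
by have := is_derive_diff_comp wd cD; rewrite diff_val.
Qed.

Lemma is_derive_monomials (I : Type) (r : seq I) (c : I -> R) (k : I -> nat)
    (w : I -> W) (t : R) :
  is_derive t 1 (fun t : R => \sum_(i <- r) (c i * t ^+ k i) *: w i)
    (\sum_(i <- r) (c i * (k i)%:R * t ^+ (k i).-1) *: w i).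
Proof.
elim: r => [|i r IH].
  rewrite (_ : (fun y => _) = cst 0); last by apply/funext=> y; rewrite big_nil.
  by rewrite big_nil; exact: is_derive_cst.
have iD : is_derive t 1 (fun t : R => (c i * t ^+ k i) *: w i)
    ((c i * (k i)%:R * t ^+ (k i).-1) *: w i).
  have pD : is_derive t 1 (fun t : R => c i * t ^+ k i : R)
      (c i * (k i)%:R * t ^+ (k i).-1).
    have iD := is_deriveZ (c i) (is_deriveX (k i) (is_derive_id t (1 : R))).
    have := is_derive_eq iD.
    rewrite (_ : c i \*: _ = (fun t : R => c i * t ^+ k i : R)).
      by apply; rewrite /GRing.scale /= mulr1 mulrA.
    apply/funext => y; rewrite fctE; congr (_ * _); exact: fctE.
  exact: is_derive_scalel.
have := is_deriveD iD IH; rewrite big_cons.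
by congr is_derive; apply/funext => y; rewrite big_cons.
Qed.

(** Multiplying by [h] a combination of expansions restores the power that
    the application of the vector field takes away from each term. *)
Lemma monomials_comb (I : Type) (r : seq I) (o : I -> nat) (w : I -> W)
    (K : finType) (al : K -> R) (c : K -> I -> R) (h : R) :
  (forall i, 0 < o i)%N ->
  \sum_(i <- r) ((\sum_k al k * c k i) * h ^+ o i) *: w i =
  h *: \sum_k al k *: \sum_(i <- r) (c k i * h ^+ (o i).-1) *: w i.
Proof.
move=> o0; rewrite scaler_sumr.
under [RHS]eq_bigr do rewrite scaler_sumr scaler_sumr.
rewrite exchange_big; apply: eq_bigr => i _ /=.
under [RHS]eq_bigr do rewrite !scalerA.
rewrite -scaler_suml mulr_suml; congr (_ *: _); apply: eq_bigr => k _.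
by rewrite -[in LHS](prednK (o0 i)) exprS; ring.
Qed.

End PolynomialCurves.

Section Taylor.
Context (R : realType) (X Y : vectType R).
Implicit Types (f : nvect X -> nvect Y) (x z : nvect X).

Definition taylor n f x z : nvect Y :=
  \sum_(m < n) (m`!%:R)^-1 *: idiff (nseq m z) f x.

Lemma smooth_locally_bounded f x : smooth f ->
  exists C : R, \forall z \near (0 : nvect X), `|f (x + z)| <= C.
Proof.
move=> /(_ 0%N) /= /(_ x) fc; exists (`|f x| + 1).
have : \forall y \near x, `|f y| <= `|f x| + 1.
  have := @cvgr_norm_le _ _ _ _ _ f (f x) fc; apply.
  by rewrite ltrDl.
by move/nbhs0P.
Qed.


(** Only the finitely many partial derivatives along the basis have to be
    bounded, and each of them is continuous. *)
Lemma smooth_locally_bounded_diff f x : smooth f ->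
  exists2 C : R, 0 <= C & \forall z \near (0 : nvect X), forall v,
    `|'d f (x + z) v| <= C * `|v|.
Proof.
move=> fs.
have /choice[C Cb] i := smooth_locally_bounded x (smooth_diff (bvec i) fs).
exists (\sum_i `|C i|); first exact: sumr_ge0.
have {Cb} : \forall z \near (0 : nvect X), forall i,
    `|'d f (x + z) (bvec i)| <= C i.
  exact: (filter_forall _ Cb).
apply: filterS => z Cb v; rewrite linear_sum_coor mulr_suml.
apply: le_trans (ler_norm_sum _ _ _) (ler_sum _ _) => i _.
rewrite normrZ mulrC ler_pM // ?normr_coor //.
exact: le_trans (Cb i) (ler_norm _).
Qed.

Lemma is_derive_segment f x v (t : R) : smooth f ->
  is_derive t (1 : R) (fun t : R => f (x + t *: v)) ('d f (x + t *: v) v).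
Proof.
move=> fs; apply: (@is_derive_diff_comp _ _ _ f (fun t : R => x + t *: v)).
  exact: smooth_differentiable.
have := is_derive_scalel v (is_derive_id t (1 : R)); rewrite scale1r => vD.
have := is_deriveD (is_derive_cst x t (1 : R)) vD.
by rewrite add0r.
Qed.

(** The mean value inequality on the segment between the two points, which
    stays in the ball by convexity. *)
Lemma smooth_locally_lipschitz f x : smooth f ->
  exists2 C : R, 0 <= C & exists2 r : R, 0 < r &
    forall z z', `|z| < r -> `|z'| < r ->
      `|f (x + z) - f (x + z')| <= C * `|z - z'|.
Proof.
move=> fs; have [C C0] := smooth_locally_bounded_diff x fs.
move=> /nbhs_norm0P[/= r r0 Cb].
exists C => //; exists r => // z z' zr z'r.
pose u t := f (x + z' + t *: (z - z')).
have := @nvect_MVT _ _ u (fun t => 'd f (x + z' + t *: (z - z')) (z - z'))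
  (C * `|z - z'|) _ _.
rewrite /u scale1r scale0r addr0 -addrA [z' + _]addrC subrK; apply.
  by move=> t _; exact: is_derive_segment.
move=> t /andP[t0 t1]; rewrite -addrA; apply: Cb => /=.
rewrite (_ : _ + _ = t *: z + (1 - t) *: z'); last first.
  by rewrite scalerBr scalerBl scale1r addrCA.
apply: le_lt_trans (ler_normD _ _) _; rewrite !normrZ !ger0_norm ?subr_ge0 //.
have [->|tN0] := eqVneq t 0; first by rewrite mul0r add0r subr0 mul1r.
have : t * `|z| < t * r by rewrite ltr_pM2l // lt_def tN0.
have : (1 - t) * `|z'| <= (1 - t) * r by rewrite ler_wpM2l ?subr_ge0 // ltW.
lra.
Qed.

(** Along a ray, the derivative of a Taylor polynomial is the combination,
    with the coordinates of the direction, of the Taylor polynomials of one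
    degree less of the partial derivatives. *)
Lemma taylorS_deriv n f x z (t : R) : smooth f ->
  is_derive t 1 (fun t : R => taylor n.+1 f x (t *: z))
    (\sum_i coor i z *: taylor n (fun y => 'd f y (bvec i)) x (t *: z)).
Proof.
move=> fs; rewrite /taylor.
have := is_derive_monomials (index_enum 'I_n.+1) (fun m => (m`!%:R)^-1)
  (fun m => m : nat) (fun m => idiff (nseq m z) f x) t.
rewrite (_ : (fun t : R => _) = (fun t : R =>
   \sum_(m < n.+1) (m`!%:R)^-1 *: idiff (nseq m (t *: z)) f x)); last first.
  apply/funext => s; apply: eq_bigr => m _.
  by rewrite idiff_nseqZ // scalerA.
move/is_derive_eq; apply.
rewrite big_ord_recl /= mulr0 mul0r scale0r add0r.
transitivity (\sum_(m < n) ((m`!%:R)^-1 * t ^+ m) *: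
    idiff (nseq m z) (fun y => 'd f y z) x).
  apply: eq_bigr => m _.
  rewrite /bump /= add1n factS natrM invfM; congr (_ *: _).
  by rewrite [_^-1 * _ * _]mulrAC mulVf ?mul1r // pnatr_eq0.
under [RHS]eq_bigr do rewrite scaler_sumr.
rewrite exchange_big /=; apply: eq_bigr => m _.
rewrite (_ : (fun y => _) = (fun y => \sum_i coor i z *: 'd f y (bvec i))).
  rewrite idiff_comb ?scaler_sumr; last by move=> i; exact: smooth_diff.
  apply: eq_bigr => i _; rewrite idiff_nseqZ; last exact: smooth_diff.
  by rewrite !scalerA; congr (_ *: _); ring.
by apply/funext => y; rewrite linear_sum_coor.
Qed.

(** Induction on [n] for all functions at once: along the ray from [x] to
    [x + z], the derivative of the remainder of [f] is the combination of the
    remainders of the partial derivatives of [f] with the coordinates of [z] as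
    coefficients, hence O(|z|^(n+1)) by induction, and the mean value
    inequality applies. *)
Lemma taylor_remainder n f x : smooth f ->
  exists2 C : R, 0 <= C & \forall z \near (0 : nvect X),
    `|f (x + z) - taylor n f x z| <= C * `|z| ^+ n.
Proof.
elim: n f => [|n IH] f fs.
  have [C Cb] := smooth_locally_bounded x fs.
  exists `|C| => //; apply: filterS Cb => z Cz.
  by rewrite /taylor big_ord0 subr0 mulr1 (le_trans Cz) // ler_norm.
pose g i := fun y => 'd f y (bvec i).
have gs i : smooth (g i) by exact: smooth_diff.
have /choice[C Cb] i : exists C, 0 <= C /\ \forall z \near (0 : nvect X),
    `|g i (x + z) - taylor n (g i) x z| <= C * `|z| ^+ n.
  by have [C C0 Cb] := IH _ (gs i); exists C.
exists (\sum_i C i); first by apply: sumr_ge0 => i _; case: (Cb i).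
have : \forall z \near (0 : nvect X), forall i,
    `|g i (x + z) - taylor n (g i) x z| <= C i * `|z| ^+ n.
  by apply: (filter_forall _ (fun i => (Cb i).2)).
move=> /nbhs_norm0P[/= r r0 gr]; apply/nbhs_norm0P; exists r => //= z zr.
pose u t := f (x + t *: z) - taylor n.+1 f x (t *: z).
have := @nvect_MVT _ _ u (fun t => \sum_i
  coor i z *: (g i (x + t *: z) - taylor n (g i) x (t *: z)))
  ((\sum_i C i) * `|z| ^+ n.+1) _ _.
have u0 : u 0 = 0.
  rewrite /u scale0r addr0 /taylor big_ord_recl invr1 scale1r big1.
    by rewrite addr0 subrr.
  move=> m _; rewrite -[X in nseq _ X](scale0r (0 : nvect X)).
  by rewrite idiff_nseqZ // exprS mul0r scale0r scaler0.
rewrite u0 /u scale1r subr0; apply.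
  move=> t _.
  have := is_deriveB (is_derive_segment x z t fs) (taylorS_deriv n x z t fs).
  move/is_derive_eq; apply; rewrite linear_sum_coor -sumrB.
  by apply: eq_bigr => i _; rewrite scalerBr.
move=> t /andP[t0 t1]; have tzz : `|t *: z| <= `|z|.
  by rewrite normrZ ger0_norm // ler_piMl.
rewrite mulr_suml; apply: le_trans (ler_norm_sum _ _ _) (ler_sum _ _) => i _.
rewrite normrZ exprS mulrCA ler_pM ?normr_coor //.
apply: le_trans (gr _ _ i) _; first exact: le_lt_trans zr.
by rewrite ler_wpM2l ?lerXn2r ?nnegrE //; case: (Cb i).
Qed.

End Taylor.

(** * Expansions in planar trees *)

Definition isO (R : realType) (V : normedModType R) (n : nat) (u : R -> V) :=
  exists C : R, \forall h \near (0 : R), `|u h| <= C * `|h| ^+ n.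

Section NearZero.
Context (R : realType) (V : normedModType R).
Implicit Types u v : R -> V.

Lemma isO_ge0 n u : isO n u ->
  exists2 C : R, 0 <= C & \forall h \near (0 : R), `|u h| <= C * `|h| ^+ n.
Proof.
move=> [C uC]; exists `|C| => //; apply: filterS uC => h /le_trans; apply.
by rewrite ler_wpM2r ?exprn_ge0 // ler_norm.
Qed.

Lemma isO_eq n u v : (\forall h \near (0 : R), u h = v h) -> isO n u -> isO n v.
Proof.
move=> uv [C uC]; exists C; apply: filterS2 uv uC => h -> //.
Qed.

Lemma isO_le n (W : normedModType R) (C : R) (v : R -> W) u :
  (\forall h \near (0 : R), `|u h| <= C * `|v h|) -> isO n v -> isO n u.
Proof.
move=> uv [D vD]; exists (`|C| * D); apply: filterS2 uv vD => h /le_trans uv vD.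
apply: uv; apply: (@le_trans _ _ (`|C| * `|v h|)).
  by rewrite ler_wpM2r // ler_norm.
by rewrite -mulrA ler_wpM2l.
Qed.

Lemma isOD n u v : isO n u -> isO n v -> isO n (fun h => u h + v h).
Proof.
move=> [C uC] [D vD]; exists (C + D); apply: filterS2 uC vD => h uC vD.
by rewrite (le_trans (ler_normD _ _)) // mulrDl lerD.
Qed.

Lemma isO0 n : isO n (fun=> 0 : V).
Proof. by exists 0; apply: filterE => h; rewrite normr0 mul0r. Qed.

Lemma isO_sum n (I : eqType) (r : seq I) (u : I -> R -> V) :
  {in r, forall i, isO n (u i)} -> isO n (fun h => \sum_(i <- r) u i h).
Proof.
elim: r => [_|i r IH ur].
  by apply: isO_eq (isO0 n); apply: filterE => h; rewrite big_nil.
have uiO : isO n (u i) by apply: ur; rewrite mem_head.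
have urO : isO n (fun h => \sum_(j <- r) u j h).
  by apply: IH => j jr; apply: ur; rewrite inE jr orbT.
by apply: isO_eq (isOD uiO urO); apply: filterE => h; rewrite big_cons.
Qed.

Lemma isOZ n (c : R) u : isO n u -> isO n (fun h => c *: u h).
Proof. by apply: (@isO_le n V `|c|); apply: filterE => h; rewrite normrZ. Qed.

Lemma isO_scale n u : isO n u -> isO n.+1 (fun h => h *: u h).
Proof.
move=> [C uC]; exists C; apply: filterS uC => h uC.
by rewrite normrZ exprS mulrCA ler_wpM2l.
Qed.

Lemma isO_leq m n u : (m <= n)%N -> isO n u -> isO m u.
Proof.
move=> mn /isO_ge0[C C0 uC]; exists C.
have h1 : \forall h \near (0 : R), `|h| <= 1.
  by apply/nbhs_norm0P; exists 1 => //= h /ltW.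
apply: filterS2 uC h1 => h /le_trans uC h1; apply: uC.
by rewrite ler_wpM2l // ler_wiXn2l.
Qed.

Lemma isO_monomial k n (c : R) (w : V) : (n <= k)%N ->
  isO n (fun h => (c * h ^+ k) *: w).
Proof.
move=> nk; apply: (isO_leq nk); exists (`|c| * `|w|); apply: filterE => h.
by rewrite normrZ normrM normrX mulrAC.
Qed.

Lemma isO_small n u (r : R) : 0 < r -> isO n.+1 u ->
  \forall h \near (0 : R), `|u h| < r.
Proof.
move=> r0 /(isO_leq (ltn0Sn n)) /isO_ge0[C C0 uC].
have hr : \forall h \near (0 : R), `|h| < r / (C + 1).
  by apply/nbhs_norm0P; exists (r / (C + 1)) => //=; rewrite divr_gt0 ?ltr_wpDl.
apply: filterS2 uC hr => h /le_lt_trans uC hr; apply: uC.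
rewrite expr1; move: hr; rewrite ltr_pdivlMr ?ltr_wpDl // => hr.
by apply: le_lt_trans hr; rewrite mulrC ler_wpM2l // lerDl.
Qed.

End NearZero.

Lemma isO_linear (R : realType) (X : vectType R) (W : normedModType R) n
    (f : {linear nvect X -> W}) (u : R -> nvect X) :
  isO n u -> isO n (fun h => f (u h)).
Proof.
have [k _ fk] := nvect_linear_lipschitz f.
by apply: (@isO_le _ _ n _ k); apply: filterE => h; exact: fk.
Qed.

Section ElementaryDifferentials.
Context (R : realType) (M : nat) (X : vectType R).

Local Notation XM := (nvect {ffun 'I_M -> X}).

Definition slot (l : 'I_M) (x : nvect X) : XM :=
  [ffun k => if k == l then (x : X) else 0].

Lemma slot_is_linear l : linear (slot l).
Proof.
move=> a x y; apply/ffunP => k; rewrite !ffunE.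
by case: eqP => // _; rewrite scaler0 addr0.
Qed.
HB.instance Definition _ l :=
  GRing.isLinear.Build R (nvect X) XM _ (slot l) (slot_is_linear l).

Lemma sum_slot (z : XM) : z = \sum_l slot l ((z : {ffun _}) l).
Proof.
apply/ffunP => k; rewrite sum_ffunE (bigD1 k) //= ffunE eqxx big1 ?addr0 //.
by move=> l lk; rewrite ffunE eq_sym (negPf lk).
Qed.

Context (F : XM -> nvect X) (y0 : nvect X).

Definition diag : XM := [ffun=> (y0 : X)].

(** The elementary differential of a planar tree divided by the product,
    over its nodes, of the factorials of the numbers of children. Summing over
    the planar representatives of an edge-colored tree turns these factors into
    the inverse of its symmetry coefficient. *)
Fixpoint eldiff (t : ptree M) : nvect X :=
  let: PNode cs := t in
  ((size cs)`!%:R)^-1 *: idiff [seq slot c.2 (eldiff c.1) | c <- cs] F diag.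

(** [trees n] contains every planar tree of order at most [n], and for
    larger [n] also trees of higher order: it is defined so that substituting a
    sum over [trees n] in a Taylor polynomial of degree [n] gives exactly a sum
    over [trees n.+1]. *)
Fixpoint trees (n : nat) : seq (ptree M) :=
  if n is n'.+1 then
    [seq PNode cs | m <- iota 0 n,
       cs <- words [seq (t, l) | t <- trees n', l <- index_enum 'I_M] m]
  else [::].

Definition bseries n (c : ptree M -> R) (e : ptree M -> nat) (h : R) :
    nvect X :=
  \sum_(t <- trees n) (c t * h ^+ e t) *: eldiff t.

(** The coefficients of the expansion of F at (Y_1, .., Y_M) when [c l] are
    those of Y_l. *)
Definition raise (c : 'I_M -> ptree M -> R) (t : ptree M) : R :=
  let: PNode cs := t in \prod_(b <- cs) c b.2 b.1.

Lemma porder_gt0 (t : ptree M) : (0 < porder t)%N. Proof. by case: t. Qed.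

Lemma size_words (I : eqType) (L : seq I) m cs :
  cs \in words L m -> size cs = m.
Proof.
elim: m cs => [|m IH] cs /=; first by rewrite inE => /eqP ->.
by case/allpairsP => -[c ds] [_ /IH /= <- ->].
Qed.

(** Expanding the m-th Taylor term over words of length [m] in the pairs
    (tree, slot) enumerates the trees whose root has [m] children. The root
    itself contributes no power of [h], whence the exponent [(porder t).-1]. *)
Lemma taylor_bseries n (c : 'I_M -> ptree M -> R) h : smooth F ->
  taylor n.+1 F diag (\sum_l slot l (bseries n (c l) (@porder M) h)) =
  bseries n.+1 (raise c) (fun t => (porder t).-1) h.
Proof.
move=> Fs.
set d := \sum_l _; rewrite /bseries big_allpairs_dep /taylor.
transitivity (\sum_(0 <= m < n.+1) (m`!%:R)^-1 *: idiff (nseq m d) F diag).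
  by rewrite big_mkord.
rewrite /index_iota subn0; apply: eq_bigr => m _; rewrite /d {d}.
pose al (b : ptree M * 'I_M) := c b.2 b.1 * h ^+ porder b.1.
pose e (b : ptree M * 'I_M) := slot b.2 (eldiff b.1).
rewrite [X in nseq _ X](_ : _ =
  \sum_(b <- [seq (t, l) | t <- trees n, l <- index_enum 'I_M]) al b *: e b);
  last first.
  under eq_bigr do rewrite linear_sum; rewrite exchange_big big_allpairs_dep /=.
  by apply: eq_bigr => t _; apply: eq_bigr => l _; rewrite linearZ.
rewrite idiff_nseq_comb // scaler_sumr; apply: eq_big_seq => cs /size_words csm.
rewrite /= csm scalerA [RHS]scalerA mulrC; congr (_ * _ *: _).
rewrite /al big_split; congr (_ * _).
by rewrite -[foldr _ _ _]/(porder (PNode cs)).-1 porderE /= prodrXr.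
Qed.


Lemma isO_bseries n c : isO 1 (bseries n c (@porder M)).
Proof.
apply: (@isO_sum _ _ 1 _ (trees n)
  (fun t h => (c t * h ^+ porder t) *: eldiff t)) => t _.
exact: isO_monomial (porder_gt0 t).
Qed.

(** The error of the arguments passes to F by the local Lipschitz bound,
    and the increment being O(h), the Taylor remainder is O(h^(n+1)); the rest
    is [taylor_bseries]. *)
Lemma bseries_step n (c : 'I_M -> ptree M -> R) (Z : R -> 'I_M -> nvect X) :
  smooth F ->
  (forall l, isO n.+1 (fun h => Z h l - y0 - bseries n (c l) (@porder M) h)) ->
  isO n.+1 (fun h => F [ffun l => Z h l] -
    bseries n.+1 (raise c) (fun t => (porder t).-1) h).
Proof.
move=> Fs Zc.
(* [ze] is the increment of the arguments and [dl] its expansion. *)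
pose dl h := \sum_l slot l (bseries n (c l) (@porder M) h) : XM.
pose ze h := ([ffun l => Z h l] : XM) - diag.
have zedl : isO n.+1 (fun h => ze h - dl h).
  apply: (@isO_eq _ _ _ (fun h =>
    \sum_l slot l (Z h l - y0 - bseries n (c l) (@porder M) h))).
    apply: filterE => h; rewrite /dl [ze h]sum_slot -sumrB.
    by apply: eq_bigr => l _; rewrite linearB /= !ffunE.
  by apply: isO_sum => l _; apply: isO_linear; exact: Zc.
have dl1 : isO 1 dl.
  apply: isO_sum => l _; apply: isO_linear; exact: isO_bseries.
have ze1 : isO 1 ze.
  apply: (@isO_eq _ _ _ (fun h => (ze h - dl h) + dl h)).
    by apply: filterE => h /=; rewrite subrK.
  by apply: isOD => //; exact: isO_leq zedl.
have [C C0 [r r0 FC]] := smooth_locally_lipschitz diag Fs.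
have [D D0 FD] := taylor_remainder n.+1 diag Fs.
apply: (@isO_eq _ _ _ (fun h => (F (diag + ze h) - F (diag + dl h)) +
    (F (diag + dl h) - taylor n.+1 F diag (dl h)))).
  apply: filterE => h /=; rewrite subrKA /dl taylor_bseries //.
  by rewrite /ze [diag + _]addrC subrK.
apply: isOD.
  apply: (@isO_le _ _ _ _ C _ _ _ zedl).
  apply: filterS2 (isO_small r0 ze1) (isO_small r0 dl1) => h zer dlr.
  exact: FC.
have [e e0 {}FD] : exists2 e : R, 0 < e & forall z, `|z| < e ->
    `|F (diag + z) - taylor n.+1 F diag z| <= D * `|z| ^+ n.+1.
  by have /nbhs_norm0P[/= e e0 FDe] := FD; exists e => // z; exact: FDe.
have [B B0 dlB] := isO_ge0 dl1.
exists (D * B ^+ n.+1); apply: filterS2 dlB (isO_small e0 dl1) => h dlB dle.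
apply: le_trans (FD _ dle) _.
by rewrite -mulrA ler_wpM2l // -exprMn lerXn2r ?nnegrE ?mulr_ge0.
Qed.

End ElementaryDifferentials.

(** * The tree conditions imply the order *)

Section OrderFromTrees.
Context (R : realType) (M : nat) (X : vectType R).
Local Notation XM := (nvect {ffun 'I_M -> X}).
Context (F : XM -> nvect X) (y0 : nvect X).
Hypothesis Fs : smooth F.

(** The induction starts here: F is bounded along continuous arguments, so
    that the stages and the exact solution are y0 + O(h). *)
Lemma isO_F_continuous (Z : R -> 'I_M -> nvect X) :
  (forall l, {for 0, continuous (fun h => Z h l)}) ->
  isO 0 (fun h => F [ffun l => Z h l]).
Proof.
move=> Zc; pose ZZ h := \sum_l slot l (Z h l) : XM.
have ZZE h : [ffun l => Z h l] = ZZ h :> XM.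
  by rewrite [LHS]sum_slot; apply: eq_bigr => l _; rewrite ffunE.
have ZZc : {for 0, continuous ZZ}.
  rewrite /continuous_at /ZZ.
  apply: (cvg_big (op := +%R)) => [|l _]; first exact: add_continuous.
  exact: continuous_comp (Zc l) (@nvect_linear_continuous _ _ _ (slot l) _).
have FZc : {for 0, continuous (F \o ZZ)}.
  by apply: continuous_comp ZZc _; exact: (Fs 0%N).
exists (`|F (ZZ 0)| + 1).
have : \forall h \near (0 : R), `|(F \o ZZ) h| <= `|F (ZZ 0)| + 1.
  by have := @cvgr_norm_le _ _ _ _ _ _ _ FZc; apply; rewrite ltrDl.
by apply: filterS => h; rewrite /= ZZE expr0 mulr1.
Qed.

(** The mean value inequality for [t |-> u (t * h)] on the unit interval,
    which treats positive and negative [h] alike. *)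
Lemma isO_integrate n (u du : R -> nvect X) :
  u 0 = 0 -> (\forall h \near (0 : R), is_derive h (1 : R) u (du h)) ->
  isO n du -> isO n.+1 u.
Proof.
move=> u0 uD /isO_ge0[C C0 duC].
have /nbhs_norm0P[/= r r0 ur] : \forall h \near (0 : R),
    is_derive h (1 : R) u (du h) /\ `|du h| <= C * `|h| ^+ n.
  by apply: filterS2 uD duC => h; split.
exists C; apply/nbhs_norm0P; exists r => //= h hr.
have th (t : R) : 0 <= t <= 1 -> `|t * h| <= `|h|.
  by case/andP=> t0 t1; rewrite normrM ger0_norm // ler_piMl.
have := @nvect_MVT _ _ (fun t => u (t * h)) (fun t => h *: du (t * h))
  (C * `|h| ^+ n.+1) _ _.
rewrite mul1r mul0r u0 subr0; apply=> t t01.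
  have [uthD _] := ur _ (le_lt_trans (th t t01) hr).
  have hD : is_derive t (1 : R) (fun t : R => t * h : R) h.
    have := is_derive_scalel (W := R^o) h (is_derive_id t (1 : R)).
    by rewrite scale1r.
  have ud : differentiable u (t * h) by apply/derivable1_diffP; case: uthD.
  have := @is_derive_diff_comp _ _ _ u (fun t : R => t * h) t h ud hD.
  move/is_derive_eq; apply.
  by have [_ <-] := uthD; rewrite diff1E // derive1E.
have [_ duth] := ur _ (le_lt_trans (th t t01) hr).
rewrite normrZ exprS mulrCA ler_wpM2l //; apply: le_trans duth _.
by rewrite ler_wpM2l // lerXn2r ?nnegrE // th.
Qed.

Section Stages.
Context (s : nat) (a : 'I_s -> {ffun 'I_M -> 'I_s} -> R).
Context (Y : 'I_s -> R -> nvect X) (Ysol : stage_solution a F y0 Y).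

Definition stage_weight i (t : ptree M) : R := \sum_k a i k * pphi a t k.

Lemma raise_stage_weight (k : {ffun 'I_M -> 'I_s}) :
  raise (fun l => stage_weight (k l)) = (fun t => pphi a t k).
Proof. by apply/funext => -[cs]; rewrite pphiE. Qed.

Lemma isO_comb (al : {ffun 'I_M -> 'I_s} -> R) n
    (v : {ffun 'I_M -> 'I_s} -> R -> nvect X) :
  (forall k, isO n (v k)) -> isO n.+1 (fun h => h *: \sum_k al k *: v k h).
Proof.
by move=> vO; apply/isO_scale/isO_sum => k _; exact: isOZ.
Qed.

(** Each passage through the stage equations gains one order, by
    [bseries_step] and the factor [h]. *)
Lemma stage_bseries n i :
  isO n.+1 (fun h => Y i h - y0 -
    bseries F y0 n (stage_weight i) (@porder M) h).
Proof.
have [Y0 Yc YE] := Ysol.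
elim: n i => [|n IH] i.
  apply: (@isO_eq _ _ _ (fun h =>
      h *: (\sum_k a i k *: F [ffun l => Y (k l) h]))).
    apply: filterS YE => h /(_ i) ->.
    by rewrite /bseries big_nil subr0 addrC addKr.
  apply: isO_comb => k.
  exact: (isO_F_continuous (Z := fun h l => Y (k l) h)).
apply: (@isO_eq _ _ _ (fun h => h *: (\sum_k a i k *:
    (F [ffun l => Y (k l) h] -
     bseries F y0 n.+1 (fun t => pphi a t k) (fun t => (porder t).-1) h)))).
  apply: filterS YE => h /(_ i) ->.
  rewrite /bseries monomials_comb; last exact: porder_gt0.
  rewrite [X in _ = X - _]addrC addKr -scalerBr -sumrB.
  by congr (_ *: _); apply: eq_bigr => k _; rewrite scalerBr.
apply: isO_comb => k; rewrite -raise_stage_weight.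
exact: bseries_step (fun l => IH (k l)).
Qed.

Lemma nprk_step_bseries (b : {ffun 'I_M -> 'I_s} -> R) n :
  isO n.+2 (fun h => nprk_step b F y0 Y h - y0 -
    bseries F y0 n.+1 (fun t => \sum_k b k * pphi a t k) (@porder M) h).
Proof.
apply: (@isO_eq _ _ _ (fun h => h *: (\sum_k b k *:
    (F [ffun l => Y (k l) h] -
     bseries F y0 n.+1 (fun t => pphi a t k) (fun t => (porder t).-1) h)))).
  apply: filterE => h; rewrite /bseries monomials_comb; last exact: porder_gt0.
  rewrite /nprk_step.
  rewrite [X in _ = X - _]addrC addKr -scalerBr -sumrB.
  by congr (_ *: _); apply: eq_bigr => k _; rewrite scalerBr.
apply: isO_comb => k; rewrite -raise_stage_weight.
exact: bseries_step (fun l => stage_bseries n (k l)).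
Qed.

End Stages.

(** The recursion of the density: differentiating the term of [t] in the
    exact solution multiplies its coefficient by [porder t]. *)
Lemma raise_pdensity (t : ptree M) :
  raise (fun _ t => (pdensity t)%:R^-1) t =
    (pdensity t)%:R^-1 * (porder t)%:R :> R.
Proof.
case: t => cs; rewrite pdensityE natrM invfM mulrAC mulVf ?mul1r.
  by rewrite /raise natr_prod prodfV.
by rewrite pnatr_eq0.
Qed.

(** The differential equation in place of the stage equations, and an
    integration in place of the factor [h]. *)
Lemma exact_bseries n (t0 : R) (y : R -> nvect X) :
  exact_solution F t0 y0 y ->
  isO n.+1 (fun h => y (t0 + h) - y0 -
    bseries F y0 n (fun t => (pdensity t)%:R^-1) (@porder M) h).
Proof.
move=> [yt0 yD].
have {}yD : \forall h \near (0 : R), is_derive h (1 : R) (fun h => y (t0 + h))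
    (F [ffun=> y (t0 + h)]).
  have /nbhs0P := yD; apply: filterS => h yhD.
  have yd : differentiable y (t0 + h) by apply/derivable1_diffP; case: yhD.
  have sD : is_derive h (1 : R) (fun h : R => t0 + h : R) 1.
    have := is_deriveD (is_derive_cst t0 h (1 : R)) (is_derive_id h (1 : R)).
    by rewrite add0r.
  have := @is_derive_diff_comp _ _ _ y (fun h : R => t0 + h) h 1 yd sD.
  move/is_derive_eq; apply.
  by have [_ <-] := yhD; rewrite deriveE.
elim: n => [|n IH].
  apply: (@isO_eq _ _ _ (fun h => y (t0 + h) - y0)).
    by apply: filterE => h; rewrite /bseries big_nil subr0.
  apply: (@isO_integrate _ _ (fun h => F [ffun=> y (t0 + h)])).
  - by rewrite addr0 yt0 subrr.
  - apply: filterS yD => h yD.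
    have := is_deriveB yD (is_derive_cst y0 h (1 : R)).
    by rewrite subr0.
  - apply: (isO_F_continuous (Z := fun h _ => y (t0 + h))) => _.
    apply: differentiable_continuous; apply/derivable1_diffP.
    by case: (nbhs_singleton yD).
apply: (@isO_integrate _ _ (fun h => F [ffun=> y (t0 + h)] -
   bseries F y0 n.+1 (raise (fun _ t => (pdensity t)%:R^-1))
     (fun t => (porder t).-1) h)).
- rewrite addr0 yt0 subrr sub0r /bseries big1 ?oppr0 // => t _.
  by rewrite -(prednK (porder_gt0 t)) exprS mul0r mulr0 scale0r.
- apply: filterS yD => h yD.
  have := is_deriveB (is_deriveB yD (is_derive_cst y0 h (1 : R)))
    (is_derive_monomials (trees M n.+1) (fun t => (pdensity t)%:R^-1)
       (@porder M) (eldiff F y0) h).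
  move/is_derive_eq; apply; rewrite subr0; congr (_ - _).
  by apply: eq_bigr => t _; rewrite raise_pdensity.
- exact: (bseries_step Fs (Z := fun h _ => y (t0 + h)) (fun=> IH)).
Qed.

End OrderFromTrees.

Lemma Phi_pi (R : realType) (M s : nat) (a : 'I_s -> {ffun 'I_M -> 'I_s} -> R)
    (b : {ffun 'I_M -> 'I_s} -> R) (t : ptree M) :
  Phi a b (\pi_(ectree M)%qT t) = \sum_k b k * pphi a t k.
Proof.
apply: eq_bigr => k _; congr (_ * _).
by rewrite /phi (ptree_eq_pphi a (ptree_eq_repr t)).
Qed.

(** The difference of the two expansions has the coefficient [w t] below,
    which is zero up to order [p]; the trees of higher order in [trees p.+1]
    contribute to the remainder only. *)
Lemma order_of_trees (R : realType) (M s p : nat)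
    (a : 'I_s -> {ffun 'I_M -> 'I_s} -> R) (b : {ffun 'I_M -> 'I_s} -> R) :
  (forall tau : ectree M, (tree_order tau <= p)%N ->
     Phi a b tau = 1 / (density tau)%:R) -> has_order a b p.
Proof.
move=> abp X F t0 y0 y Y Fs yex Ysol.
suff [C C0 hC] : exists2 C : R, 0 <= C & \forall h \near (0 : R),
    `|nprk_step b F y0 Y h - y (t0 + h)| <= C * `|h| ^+ p.+1.
  apply/eqO_exP; exists (C + 1); first by rewrite ltr_wpDl.
  apply: filterS hC => h /le_trans; apply; rewrite normrX ler_wpM2r //.
  by rewrite lerDl.
apply: isO_ge0.
have yO := exact_bseries Fs p.+1 yex.
have sO := nprk_step_bseries Fs Ysol b p.
pose w t := \sum_k b k * pphi a t k - (pdensity t)%:R^-1.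
have wO : isO p.+1 (fun h => \sum_(t <- trees M p.+1)
    (w t * h ^+ porder t) *: eldiff F y0 t).
  apply: isO_sum => t _; have [tp|] := leqP (porder t) p; last first.
    exact: isO_monomial.
  apply: (@isO_eq _ _ _ (fun=> 0)); last exact: isO0.
  apply: filterE => h; rewrite /w -Phi_pi abp.
    rewrite /density (ptree_eq_pdensity (ptree_eq_repr t)).
    by rewrite div1r subrr mul0r scale0r.
  by rewrite /tree_order (ptree_eq_porder (ptree_eq_repr t)).
have := isOD (isOD (isO_leq (leqnSn _) sO) wO)
  (isOZ (-1) (isO_leq (leqnSn _) yO)).
apply: isO_eq; apply: filterE => h.
have -> : \sum_(t <- trees M p.+1) (w t * h ^+ porder t) *: eldiff F y0 t =
    bseries F y0 p.+1 (fun t => \sum_k b k * pphi a t k) (@porder M) h -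
    bseries F y0 p.+1 (fun t => (pdensity t)%:R^-1) (@porder M) h.
  by rewrite /bseries -sumrB; apply: eq_bigr => t _; rewrite -scalerBl -mulrBl.
rewrite scaleN1r !opprB.
set S := nprk_step _ _ _ _ _; set B1 := bseries _ _ _ _ _ _.
set B2 := bseries _ _ _ _ _ _; set y1 := y _.
by rewrite !subrKA.
Qed.

(** * The order implies the tree conditions *)

Section SmoothFunctions.
Context (R : realType) (V : normedModType R).

Lemma Cn_cst (W : normedModType R) n (c : W) : Cn n (fun _ : V => c).
Proof.
elim: n c => [|n IH] c /=; first exact: cst_continuous.
split=> [x|v]; first exact: differentiable_cst.
by under [fun x => _]eq_fun do rewrite (diff_cst c); exact: IH.
Qed.

Lemma Cn_linear (W : normedModType R) n (f : {linear V -> W}) :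
  continuous f -> Cn n f.
Proof.
case: n => [//|n] fc /=; split=> [x|v]; first exact: linear_differentiable.
rewrite (_ : (fun x => _) = fun=> f v); first exact: Cn_cst.
by apply/funext => x; rewrite diff_lin.
Qed.

Lemma CnW (W : normedModType R) n (f : V -> W) : Cn n.+1 f -> Cn n f.
Proof.
elim: n f => [|n IH] f [fd df].
  by move=> x; exact: differentiable_continuous.
by split=> // v; apply: IH; exact: df.
Qed.

Lemma CnD (W : normedModType R) n (f g : V -> W) :
  Cn n f -> Cn n g -> Cn n (fun x => f x + g x).
Proof.
elim: n f g => [|n IH] f g /=.
  by move=> fc gc x; apply: cvgD; [exact: fc|exact: gc].
move=> [fd df] [gd dg]; split=> [x|v]; first exact: differentiableD.
rewrite (_ : (fun x => _) = fun x => 'd f x v + 'd g x v); first by apply: IH.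
by apply/funext => x; rewrite (diffD (fd x) (gd x)).
Qed.

Lemma CnM n (f g : V -> R) : Cn n f -> Cn n g -> Cn n (fun x => f x * g x).
Proof.
elim: n f g => [|n IH] f g fn gn.
  by move=> x; apply: continuousM; [exact: fn|exact: gn].
have [[fd df] [gd dg]] := (fn, gn).
split=> [x|v]; first exact: differentiableM.
rewrite (_ : (fun x => _) = fun x => f x * 'd g x v + g x * 'd f x v).
  by apply: CnD; apply: IH; [exact: CnW fn|exact: dg|exact: CnW gn|exact: df].
by apply/funext => x; rewrite (diffM (fd x) (gd x)).
Qed.

Lemma Cn_scalel (W : normedModType R) n (f : V -> R) (w : W) :
  Cn n f -> Cn n (fun x => f x *: w).
Proof.
elim: n f => [|n IH] f /=.
  by move=> fc x; apply: continuousZl; exact: fc.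
move=> [fd df]; split=> [x|v]; first exact: differentiableZl.
rewrite (_ : (fun x => _) = fun x => 'd f x v *: w); first by apply: IH.
by apply/funext => x; rewrite (diffZl w (fd x)).
Qed.

Lemma Cn_prod n (I : Type) (r : seq I) (f : I -> V -> R) :
  (forall i, Cn n (f i)) -> Cn n (fun x => \prod_(i <- r) f i x).
Proof.
move=> fn; elim: r => [|i r IH].
  by under [fun x => _]eq_fun do rewrite big_nil; exact: Cn_cst.
by under [fun x => _]eq_fun do rewrite big_cons; exact: CnM.
Qed.

Lemma Cn_sum (W : normedModType R) n (I : Type) (r : seq I) (f : I -> V -> W) :
  (forall i, Cn n (f i)) -> Cn n (fun x => \sum_(i <- r) f i x).
Proof.
move=> fn; elim: r => [|i r IH].
  by under [fun x => _]eq_fun do rewrite big_nil; exact: Cn_cst.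
by under [fun x => _]eq_fun do rewrite big_cons; exact: CnD.
Qed.

End SmoothFunctions.

(** A monomial of degree [n] that is O(h^(n+1)) vanishes: divide by h^n and
    choose [h] small in comparison with the coefficient. *)
Lemma isO_monomial_eq0 (R : realType) n (d : R) :
  isO n.+1 (fun h : R => d * h ^+ n : R^o) -> d = 0.
Proof.
move=> /isO_ge0[C C0 /nbhs_norm0P[/= r r0 dC]]; apply/eqP; apply: contraT => d0.
(* Small enough for [dC] to apply, and for [C * h] to be below [`|d|]. *)
pose h := Num.min (r / 2) (`|d| / (C + 1)).
have h0 : 0 < h by rewrite lt_min !divr_gt0 ?normr_gt0 ?ltr_wpDl.
have hr : h < r.
  by rewrite gt_min ltr_pdivrMr // ltr_pMr // ltr1n.
have := dC h; rewrite /= gtr0_norm // => /(_ hr).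
rewrite normrM [`|h ^+ n|]gtr0_norm ?exprn_gt0 // exprS mulrA.
rewrite ler_pM2r ?exprn_gt0 //.
have : h <= `|d| / (C + 1) by rewrite ge_min lexx orbT.
by rewrite ler_pdivlMr ?ltr_wpDl // mulrDr mulr1 mulrC; lra.
Qed.

Section TreeSystem.
Context (R : realType) (M : nat).

Fixpoint subtrees (t : ptree M) : seq (ptree M) :=
  let: PNode cs := t in t :: flatten [seq subtrees b.1 | b <- cs].

Lemma subtrees_self t : t \in subtrees t.
Proof. by case: t => cs; rewrite /= mem_head. Qed.

Lemma porder_child (cs : seq (ptree M * 'I_M)) b :
  b \in cs -> (porder b.1 < porder (PNode cs))%N.
Proof. by move=> bcs; rewrite porderE ltnS (big_rem b) //= leq_addr. Qed.

(** The unknowns of the system attached to a tree are its subtrees; the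
    equations are closed because each child of a subtree is again a subtree. *)
Lemma subtrees_child t cs b :
  PNode cs \in subtrees t -> b \in cs -> b.1 \in subtrees t.
Proof.
have [n] := ubnP (porder t); elim: n t => // n IH [ds] dsn + bcs.
rewrite /= !inE => /predU1P[[csds]|/flatten_mapP[d dds csd]]; apply/orP; right.
  by apply/flatten_mapP; exists b; rewrite -?csds ?subtrees_self.
apply/flatten_mapP; exists d => //; apply: IH => //.
exact: leq_trans (porder_child dds) _.
Qed.

Context (t : ptree M).

Definition node := seq_sub (subtrees t).
Definition state : vectType R := {ffun node -> R^o}.
Local Notation state_M := (nvect {ffun 'I_M -> state}).

Definition unit_state (u : node) : nvect state :=
  [ffun v => (v == u)%:R : R^o] : {ffun _}.

Lemma sum_unit_state (c : node -> R) :
  ([ffun u => c u : R^o] : {ffun _}) = \sum_u c u *: unit_state u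
    :> nvect state.
Proof.
apply/ffunP => v; rewrite ffunE sum_ffunE (bigD1 v) //= !ffunE eqxx.
rewrite big1 ?addr0 => [|u uv]; first by rewrite [RHS]mulr1.
by rewrite !ffunE eq_sym (negPf uv) [LHS]mulr0.
Qed.

(** The value [0] outside the subtrees of [t] only serves to have a total
    function of [u]: the children of a subtree never fall in this case. *)
Definition entry (u : ptree M) (x : nvect state) : R :=
  if insub u is Some v then (x : {ffun node -> R^o}) v else 0.

Definition arg_entry (b : ptree M * 'I_M) (z : state_M) : R :=
  entry b.1 ((z : {ffun _}) b.2).

Lemma arg_entry_is_linear b : linear (arg_entry b : state_M -> R^o).
Proof.
move=> a x y; rewrite /arg_entry /entry; case: insub => [v|].
  by rewrite !ffunE.
by rewrite scaler0 addr0.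
Qed.
HB.instance Definition _ b :=
  GRing.isLinear.Build R state_M R^o _ (arg_entry b) (arg_entry_is_linear b).

Definition children (u : ptree M) := let: PNode cs := u in cs.

Definition tree_field (z : state_M) : nvect state :=
  \sum_(u : node) (\prod_(b <- children (val u)) arg_entry b z) *: unit_state u.

Lemma tree_field_smooth : smooth tree_field.
Proof.
move=> n; apply: Cn_sum => u; apply: Cn_scalel; apply: Cn_prod => b.
apply: (@Cn_linear _ _ _ n (arg_entry b)).
exact: (@nvect_linear_continuous _ _ _ (arg_entry b)).
Qed.

Definition monomial_state (c : ptree M -> R) (h : R) : nvect state :=
  \sum_(u : node) (c (val u) * h ^+ porder (val u)) *: unit_state u.

Lemma entry_monomial_state u c h : u \in subtrees t ->
  entry u (monomial_state c h) = c u * h ^+ porder u.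
Proof.
move=> ut; rewrite /entry insubT /monomial_state /=.
by rewrite -(sum_unit_state (fun u => c (val u) * h ^+ porder (val u))) ffunE.
Qed.

(** On states that are monomials of degree [porder u] at each subtree [u],
    the field multiplies the monomials of the children, and the orders of the
    children add up to one less than the order of [u]. *)
Lemma tree_field_monomial_state (c : 'I_M -> ptree M -> R) h :
  tree_field [ffun l => monomial_state (c l) h] =
  \sum_(u : node) (raise c (val u) * h ^+ (porder (val u)).-1) *: unit_state u.
Proof.
apply: eq_bigr => -[u /= ut] _; congr (_ *: _).
case: u ut => cs ut; rewrite /raise porderE /= -prodrXr -big_split /=.
apply: eq_big_seq => b bcs.
by rewrite /arg_entry ffunE entry_monomial_state //; exact: subtrees_child bcs.
Qed.

Lemma is_derive_monomial_state c (h : R) :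
  is_derive h (1 : R) (monomial_state c)
    (\sum_(u : node) (c (val u) * (porder (val u))%:R *
       h ^+ (porder (val u)).-1) *: unit_state u).
Proof. exact: is_derive_monomials. Qed.

Lemma monomial_state0 c : monomial_state c 0 = 0.
Proof.
rewrite /monomial_state big1 // => u _.
by rewrite -(prednK (porder_gt0 (val u))) exprS mul0r mulr0 scale0r.
Qed.

Lemma monomial_state_exact :
  exact_solution tree_field 0 0 (monomial_state (fun u => (pdensity u)%:R^-1)).
Proof.
split; first exact: monomial_state0.
apply: filterE => h; apply: is_derive_eq (is_derive_monomial_state _ h) _.
rewrite (tree_field_monomial_state (fun _ u => (pdensity u)%:R^-1)).
by apply: eq_bigr => u _; rewrite raise_pdensity.
Qed.


Context (s : nat) (a : 'I_s -> {ffun 'I_M -> 'I_s} -> R).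

Definition monomial_stage (i : 'I_s) : R -> nvect state :=
  monomial_state (stage_weight a i).

Lemma tree_field_stage (k : {ffun 'I_M -> 'I_s}) h :
  tree_field [ffun l => monomial_stage (k l) h] =
  \sum_(u : node) (pphi a (val u) k * h ^+ (porder (val u)).-1) *: unit_state u.
Proof.
by rewrite (tree_field_monomial_state (fun l => stage_weight a (k l)))
  raise_stage_weight.
Qed.

Lemma monomial_stage_solution : stage_solution a tree_field 0 monomial_stage.
Proof.
split=> [i|i|]; first exact: monomial_state0.
  apply: differentiable_continuous; apply/derivable1_diffP.
  by case: (is_derive_monomial_state (stage_weight a i) 0).
apply: filterE => h i; rewrite add0r /monomial_stage /monomial_state.
rewrite monomials_comb => [|u]; last exact: porder_gt0.
by congr (_ *: _); apply: eq_bigr => k _; rewrite tree_field_stage.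
Qed.

Lemma nprk_step_tree_field (b : {ffun 'I_M -> 'I_s} -> R) h :
  nprk_step b tree_field 0 monomial_stage h =
  monomial_state (fun u => \sum_k b k * pphi a u k) h.
Proof.
rewrite /nprk_step add0r /monomial_state monomials_comb => [|u]; last first.
  exact: porder_gt0.
by congr (_ *: _); apply: eq_bigr => k _; rewrite tree_field_stage.
Qed.

Definition root : node := SeqSub (subtrees_self t).

Definition root_entry (x : nvect state) : R := (x : {ffun node -> R^o}) root.

Lemma root_entry_is_linear : linear (root_entry : nvect state -> R^o).
Proof. by move=> c x y; rewrite /root_entry !ffunE. Qed.
HB.instance Definition _ :=
  GRing.isLinear.Build R (nvect state) R^o _ root_entry root_entry_is_linear.

Lemma root_entry_monomial_state c h :
  root_entry (monomial_state c h) = c t * h ^+ porder t.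
Proof.
rewrite /root_entry /monomial_state.
by rewrite -(sum_unit_state (fun u => c (val u) * h ^+ porder (val u))) ffunE.
Qed.

End TreeSystem.

(** The component at the root of the system attached to [t] isolates the
    condition for [t]. *)
Lemma trees_of_order (R : realType) (M s p : nat)
    (a : 'I_s -> {ffun 'I_M -> 'I_s} -> R) (b : {ffun 'I_M -> 'I_s} -> R) :
  has_order a b p ->
  forall t : ptree M, (porder t <= p)%N ->
    \sum_k b k * pphi a t k = (pdensity t)%:R^-1.
Proof.
move=> abp t tp.
have /eqO_exP[C C0 errO] := abp _ _ _ _ _ _ (tree_field_smooth R t)
  (monomial_state_exact R t) (monomial_stage_solution t a).
apply/eqP; rewrite -subr_eq0; apply/eqP.
apply: (@isO_monomial_eq0 _ (porder t)); apply: (@isO_leq _ _ _ p.+1) => //.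
pose err h := nprk_step b (tree_field (t := t)) 0 (monomial_stage t a) h -
  monomial_state t (fun u => (pdensity u)%:R^-1) (0 + h).
have : isO p.+1 (fun h => root_entry (err h)).
  apply: isO_linear; exists C; apply: filterS errO => h /le_trans; apply.
  by rewrite normrX.
apply: isO_eq; apply: filterE => h.
rewrite /err nprk_step_tree_field add0r (linearB (root_entry (t := t))).
by rewrite /= !root_entry_monomial_state mulrBl.
Qed.

Theorem theorem3p2 (R : realType) (M s p : nat)
    (a : 'I_s -> {ffun 'I_M -> 'I_s} -> R) (b : {ffun 'I_M -> 'I_s} -> R) :
  (0 < M)%N ->
  (has_order a b p <->
   forall tau : ectree M, (tree_order tau <= p)%N ->
     Phi a b tau = 1 / (density tau)%:R).
Proof.
move=> _; split=> [abp tau taup|]; last exact: order_of_trees.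
by rewrite div1r; exact: (trees_of_order abp (t := repr tau) taup).
Qed.
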